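(* Let $d,N^+,N^-\ge1$ be integers, let $M=N^+N^-$, and let $\hat z_i=(\hat x_i^+,\hat x_i^-)\in\mathbb{R}^d\times\mathbb{R}^d$, $i=1,\dots,M$, be the $M$ pairs formed by one positively labelled and one negatively labelled training data point. Let $C>0$ and $\epsilon\ge0$. Then the fixed-support distributionally robust AUC problem (DR-AUC-F) $$\min_{w\in\mathbb{R}^d}\ \Big[\tfrac12\|w\|^2+C\max_{p\in\mathcal P}\ \sum_{j=1}^M h(w;\hat z_j)\,p_j\Big],$$ with $h$ and $\mathcal P$ as defined in the context, is equivalent to the following convex quadratic programming problem: $$\begin{aligned} \min_{w\in\mathbb{R}^d,\ \lambda\ge0,\ t\in\mathbb{R}^M}\quad & \tfrac12\|w\|^2+C\Big(\frac1M\sum_{i=1}^M t_i+\lambda\epsilon\Big)\\ \text{s.t.}\quad & t_i+\lambda\big(\|\hat x_i^+-\hat x_j^+\|_1+\|\hat x_i^--\hat x_j^-\|_1\big)\ \ge\ 1-w^T(\hat x_j^+-\hat x_j^-)\quad \forall i,j\in\{1,\dots,M\},\\ & t_i+\lambda\big(\|\hat x_i^+-\hat x_j^+\|_1+\|\hat x_i^--\hat x_j^-\|_1\big)\ \ge\ 0\quad \forall i,j\in\{1,\dots,M\}. \end{aligned}$$ Here ''equivalent'' means that the two problems have the same optimal value, and that $w$ is optimal for DR-AUC-F if and only if there exist $\lambda$ and $t$ such that $(w,\lambda,t)$ is optimal for the second problem.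
   Context: $\|\cdot\|$ is the Euclidean norm and $\|\cdot\|_1$ the $\ell_1$ norm on $\mathbb{R}^d$. The pairwise hinge loss of $w\in\mathbb{R}^d$ at $z=(x^+,x^-)\in\mathbb{R}^d\times\mathbb{R}^d$ is $h(w;z)=\max\{0,\,1-(w^Tx^+-w^Tx^-)\}$. The distance between pairs is $d_z(\hat z_i,\hat z_j)=\|\hat x_i^+-\hat x_j^+\|_1+\|\hat x_i^--\hat x_j^-\|_1$. The reference distribution assigns probability $1/M$ to each atom $\hat z_i$. The ambiguity set (the Kantorovich ball of radius $\epsilon$ around the reference distribution, with support fixed to the atoms $\hat z_1,\dots,\hat z_M$) is the set $\mathcal P$ of all vectors $p=(p_1,\dots,p_M)\ge0$, $p_j$ being the probability of the $j$-th atom, for which there exists a matrix $K=(K_{ij})\in\mathbb{R}^{M\times M}$ with $K_{ij}\ge0$ such that $$\sum_{i=1}^M K_{ij}=p_j\ \ \forall j,\qquad \sum_{j=1}^M K_{ij}=\frac1M\ \ \forall i,\qquad \sum_{i=1}^M\sum_{j=1}^M d_z(\hat z_i,\hat z_j)K_{ij}\le\epsilon .$$ *)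

(* Defs.v *)
From HB Require Import structures.
From mathcomp Require Import all_boot all_order all_algebra.
From mathcomp Require Import boolp classical_sets reals constructive_ereal ereal.

Set Implicit Arguments.
Unset Strict Implicit.
Unset Printing Implicit Defensive.

Import Order.TTheory GRing.Theory Num.Theory.

Local Open Scope classical_set_scope.
Local Open Scope ring_scope.

Section OptimizationProblems.
Variable R : realType.

(* Minimization of [f] over [feas]; values are extended reals, so that the
   optimal value exists whether or not it is attained. *)
Definition optimal_value (T : Type) (feas : set T) (f : T -> \bar R) : \bar R :=
  ereal_inf (f @` feas).

Definition optimal (T : Type) (feas : set T) (f : T -> \bar R) (x : T) : Prop :=
  feas x /\ forall y, feas y -> (f x <= f y)%E.

Definition convex_quadratic_program (n : nat) (feas : set 'cV[R]_n)
    (f : 'cV[R]_n -> R) : Prop :=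
  (exists (Q : 'M[R]_n) (c : 'cV[R]_n),
     [/\ Q^T = Q,
         forall x : 'cV[R]_n, 0 <= (x^T *m Q *m x) 0 0 &
         forall x, f x = 2^-1 * (x^T *m Q *m x) 0 0 + (c^T *m x) 0 0])
  /\ (exists (I : finType) (a : I -> 'cV[R]_n) (b : I -> R),
        feas = [set x | forall k, b k <= ((a k)^T *m x) 0 0]).

End OptimizationProblems.

Section DistributionallyRobustAUC.
Variables (R : realType) (d M : nat).

(* The norm [`|x|] that the library puts on matrices is the sup norm. *)
Definition l2norm (x : 'cV[R]_d) : R := Num.sqrt (\sum_i x i 0 ^+ 2).
Definition l1norm (x : 'cV[R]_d) : R := \sum_i `|x i 0|.

Definition hinge (w : 'cV[R]_d) (z : 'cV[R]_d * 'cV[R]_d) : R :=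
  Num.max 0 (1 - ((w^T *m z.1) 0 0 - (w^T *m z.2) 0 0)).

Definition dist_pair (z z' : 'cV[R]_d * 'cV[R]_d) : R :=
  l1norm (z.1 - z'.1) + l1norm (z.2 - z'.2).

Variables (z : 'I_M -> 'cV[R]_d * 'cV[R]_d) (C eps : R).

Definition ambiguity_set : set 'cV[R]_M :=
  [set p | (forall j, 0 <= p j 0) /\
     exists K : 'M[R]_M,
       [/\ forall i j, 0 <= K i j,
           forall j, \sum_i K i j = p j 0,
           forall i, \sum_j K i j = M%:R^-1 &
           \sum_i \sum_j dist_pair (z i) (z j) * K i j <= eps]].

Definition expected_hinge (w : 'cV[R]_d) (p : 'cV[R]_M) : R :=
  \sum_j hinge w (z j) * p j 0.

Definition worst_case_hinge (w : 'cV[R]_d) : \bar R :=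
  ereal_sup [set (expected_hinge w p)%:E | p in ambiguity_set].

Definition drauc_objective (w : 'cV[R]_d) : \bar R :=
  ((2^-1 * l2norm w ^+ 2)%:E + C%:E * worst_case_hinge w)%E.

Definition qp_objective (v : 'cV[R]_d * R * 'cV[R]_M) : R :=
  let: (w, lambda, t) := v in
  2^-1 * l2norm w ^+ 2 + C * (M%:R^-1 * (\sum_i t i 0) + lambda * eps).

Definition qp_feasible : set ('cV[R]_d * R * 'cV[R]_M) :=
  [set v : 'cV[R]_d * R * 'cV[R]_M | let: (w, lambda, t) := v in
     [/\ 0 <= lambda,
         forall i j,
           t i 0 + lambda * (l1norm ((z i).1 - (z j).1)
                             + l1norm ((z i).2 - (z j).2))
             >= 1 - (w^T *m ((z j).1 - (z j).2)) 0 0 &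
         forall i j,
           t i 0 + lambda * (l1norm ((z i).1 - (z j).1)
                             + l1norm ((z i).2 - (z j).2)) >= 0]].

(* Reads a stacked column [w; lambda; t] as the triple (w, lambda, t). *)
Definition unstack (x : 'cV[R]_(d + (1 + M))) : 'cV[R]_d * R * 'cV[R]_M :=
  (usubmx x, usubmx (dsubmx x) 0 0, dsubmx (dsubmx x)).

End DistributionallyRobustAUC.

(* Main.v *)
(* For fixed w the inner problem is a transport problem with uniform first
   marginal and a single extra constraint, the budget eps.  Without the budget
   its vertices are the maps s sending all the mass of atom i to atom s(i); each
   has a cost c(s) and a value v(s), and the identity has cost 0.  The optimum
   under the budget is the height at eps of the upper concave envelope of the
   finitely many points (c(s), v(s)), attained by a mixture of at most two maps,
   and a slope of the envelope there is an optimal multiplier lambda, with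
   t_i = max_j (h(w; z_j) - lambda d(z_i, z_j)).  So duality is exact and attained
   for every w, and minimizing over w gives the equivalence. *)
Require Import Defs.
From HB Require Import structures.
From mathcomp Require Import all_boot all_order all_algebra.
From mathcomp Require Import boolp classical_sets reals constructive_ereal ereal.
From mathcomp Require Import ring lra.

Set Implicit Arguments.
Unset Strict Implicit.
Unset Printing Implicit Defensive.

Import Order.TTheory GRing.Theory Num.Theory.

Local Open Scope classical_set_scope.
Local Open Scope ring_scope.

(* The mixture of [a] and [b] is the height at [e] of the upper concave envelope
   of the points [(c s, v s)], and [lam] is a slope of the envelope there.  The
   height is found as the largest chord value at [e] over pairs straddling [e],
   which is exactly what makes the slope bounds from both sides compatible. *)
Lemma concave_envelope_support (R : realFieldType) (S : finType) (c v : S -> R)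
    (e : R) (s0 : S) : c s0 <= e ->
  exists (lam theta : R) (a b : S),
    [/\ 0 <= lam, 0 <= theta <= 1, theta * c a + (1 - theta) * c b <= e &
        forall s, v s <= theta * v a + (1 - theta) * v b + lam * (c s - e)].
Proof.
move=> cs0.
(* [th a b] is the weight of [a] at which the chord from [a] to [b] has cost [e]; the default 1,
   when [b] also lies within [e], makes the chord value just [v a]. *)
pose th a b := if c b <= e then 1 else (c b - e) / (c b - c a).
pose V (q : S * S) := th q.1 q.2 * v q.1 + (1 - th q.1 q.2) * v q.2.
have [[a b] /= ca Vmax] : exists2 q : S * S,
    c q.1 <= e & forall q', c q'.1 <= e -> V q' <= V q.
  have P0 : c (s0, s0).1 <= e by [].
  case: (@Order.TotalTheory.arg_maxP _ _ _ (s0, s0) (fun q => c q.1 <= e) V P0).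
  by move=> q cq qmax; exists q.
pose W := V (a, b).
have W_A s : c s <= e -> v s <= W.
  by move=> cs; have := Vmax (s, s) cs; rewrite {1}/V /th /= cs -/W; lra.
(* Maximality against the pair [(s, u)], cleared of denominators: seen from [(e, W)], no slope to
   the right exceeds a slope to the left. *)
have W_AB s u : c s <= e -> e < c u ->
    (v u - W) * (e - c s) <= (W - v s) * (c u - e).
  move=> cs cu; have := Vmax (s, u) cs; rewrite {1}/V /th /= [c u <= e]leNgt cu /= -/W.
  have k0 : 0 < c u - c s by lra.
  have -> : (c u - e) / (c u - c s) * v s + (1 - (c u - e) / (c u - c s)) * v u
      = ((c u - e) * v s + (e - c s) * v u) / (c u - c s) by field; lra.
  by rewrite ler_pdivrMr //; lra.
(* The steepest slope from [(e, W)] to a point beyond [e]; the default 0 gives the sign and covers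
   the case of no such point. *)
pose lam := \big[Num.max/0]_(u | e < c u) ((v u - W) / (c u - e)).
have lam0 : 0 <= lam by exact: bigmax_ge_id.
exists lam, (th a b), a, b; split => //.
- rewrite /th; case: (leP (c b) e) => cb; first by rewrite ler01 lexx.
  have k0 : 0 < c b - c a by lra.
  by rewrite divr_ge0 ?ler_pdivrMr //; lra.
- rewrite /th; case: (leP (c b) e) => cb; first by lra.
  have -> : (c b - e) / (c b - c a) * c a + (1 - (c b - e) / (c b - c a)) * c b
    = e by field; lra.
  by [].
- rewrite -/(V (a, b)) -/W => s; case: (leP (c s) e) => cs; last first.
    have : (v s - W) / (c s - e) <= lam.
      by apply: (@le_bigmax_cond _ _ _ _ _ _ (fun u => (v u - W) / (c u - e))).
    by rewrite ler_pdivrMr; lra.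
  suff : lam * (e - c s) <= W - v s by lra.
  have := cs; rewrite le_eqVlt => /orP[/eqP cse|cse].
    by have := W_A s cs; rewrite cse subrr mulr0; lra.
  have k0 : 0 < e - c s by lra.
  (* The left slope at [s] bounds the default 0, by [W_A], and every right slope, by [W_AB]. *)
  rewrite -ler_pdivlMr //; apply: bigmax_le => [|u cu].
    by rewrite divr_ge0 //; have := W_A s cs; lra.
  have l0 : 0 < c u - e by lra.
  rewrite ler_pdivrMr // mulrAC ler_pdivlMr //; exact: W_AB.
Qed.

(** * Exact duality of the inner transport problem at fixed [w] *)

Section InnerDuality.
Variables (R : realType) (d M : nat) (z : 'I_M -> 'cV[R]_d * 'cV[R]_d).
Variable eps : R.

Implicit Types (w : 'cV[R]_d) (t : 'cV[R]_M).

Lemma qp_feasibleE w lambda t : qp_feasible z (w, lambda, t) <->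
  0 <= lambda /\
  forall i j, hinge w (z j) <= t i 0 + lambda * dist_pair (z i) (z j).
Proof.
have E j : 1 - (w^T *m ((z j).1 - (z j).2)) 0 0
    = 1 - ((w^T *m (z j).1) 0 0 - (w^T *m (z j).2) 0 0).
  by rewrite mulmxBr !mxE.
split=> [[l0 h1 h0]|[l0 h]]; split=> // i j.
- by rewrite /hinge ge_max h0 -E h1.
- by rewrite E; have := h i j; rewrite /hinge ge_max => /andP[].
- by have := h i j; rewrite /hinge ge_max => /andP[].
Qed.

Lemma dist_pair_refl (y : 'cV[R]_d * 'cV[R]_d) : dist_pair y y = 0.
Proof.
by rewrite /dist_pair /l1norm !subrr !big1 ?addr0 // => i _; rewrite mxE normr0.
Qed.

(** Weight constraint [(i, j)] by [K i j] and sum: the row sums of [K] produce the mean of [t], and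
    as [lambda] is nonnegative the budget bounds the transport term. *)
Lemma weak_duality w lambda t p :
  qp_feasible z (w, lambda, t) -> ambiguity_set z eps p ->
  expected_hinge z w p <= M%:R^-1 * (\sum_i t i 0) + lambda * eps.
Proof.
move=> /qp_feasibleE[l0 h] [_ [K [K0 Kp KM Keps]]].
apply: (@le_trans _ _
    (\sum_i \sum_j (t i 0 + lambda * dist_pair (z i) (z j)) * K i j)).
  rewrite exchange_big; apply: ler_sum => j _; rewrite -Kp mulr_sumr.
  by apply: ler_sum => i _; rewrite ler_wpM2r.
have -> : \sum_i \sum_j (t i 0 + lambda * dist_pair (z i) (z j)) * K i j =
    M%:R^-1 * (\sum_i t i 0)
    + lambda * (\sum_i \sum_j dist_pair (z i) (z j) * K i j).
  rewrite !mulr_sumr -big_split; apply: eq_bigr => i _ /=.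
  rewrite -(KM i) mulr_suml mulr_sumr -big_split; apply: eq_bigr => j _ /=.
  by rewrite mulrDl mulrA [K i j * _]mulrC.
by rewrite lerD2l ler_wpM2l.
Qed.

(* A vertex of the transport polytope with uniform first marginal sends all
   the mass of atom [i] to one atom [s i]. *)
Definition map_cost (s : {ffun 'I_M -> 'I_M}) : R :=
  M%:R^-1 * \sum_i dist_pair (z i) (z (s i)).

Definition map_value w (s : {ffun 'I_M -> 'I_M}) : R :=
  M%:R^-1 * \sum_i hinge w (z (s i)).

Definition map_plan (s : {ffun 'I_M -> 'I_M}) : 'M[R]_M :=
  \matrix_(i, j) (M%:R^-1 *+ (s i == j)).

Lemma sum_map_plan s (f : 'I_M -> R) i :
  \sum_j f j * map_plan s i j = M%:R^-1 * f (s i).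
Proof.
rewrite (bigD1 (s i)) //= big1 ?addr0 ?mxE ?eqxx ?mulr1n 1?mulrC // => j.
by rewrite mxE eq_sym => /negPf ->; rewrite mulr0n mulr0.
Qed.

(** An arbitrary [f] lets this serve both the transport cost and the expected loss. *)
Lemma sum_mixed_plan (theta : R) a b (f : 'I_M -> 'I_M -> R) :
  \sum_i \sum_j f i j * (theta *: map_plan a + (1 - theta) *: map_plan b) i j
  = theta * (M%:R^-1 * \sum_i f i (a i))
    + (1 - theta) * (M%:R^-1 * \sum_i f i (b i)).
Proof.
rewrite !mulr_sumr -big_split; apply: eq_bigr => i _ /=.
rewrite -!sum_map_plan !mulr_sumr -big_split; apply: eq_bigr => j _ /=.
by rewrite !mxE; ring.
Qed.

Lemma mixed_map_ambiguity (theta : R) a b : 0 <= theta <= 1 ->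
  theta * map_cost a + (1 - theta) * map_cost b <= eps ->
  exists2 p, ambiguity_set z eps p &
    forall w, expected_hinge z w p
      = theta * map_value w a + (1 - theta) * map_value w b.
Proof.
move=> /andP[th0 th1] cost.
pose K := theta *: map_plan a + (1 - theta) *: map_plan b.
have K0 i j : 0 <= K i j.
  by rewrite !mxE addr_ge0 // mulr_ge0 ?subr_ge0 // mulrn_wge0 // invr_ge0.
exists (\col_j \sum_i K i j).
  split=> [j|]; first by rewrite mxE sumr_ge0.
  exists K; split=> // [j|i|]; first by rewrite mxE.
    have S s : \sum_j map_plan s i j = M%:R^-1.
      rewrite -[RHS]mulr1 -(sum_map_plan s (fun=> 1) i).
      by apply: eq_bigr => j _; rewrite mul1r.
    rewrite (eq_bigr (fun j => theta * map_plan a i j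
        + (1 - theta) * map_plan b i j)); last by move=> j _; rewrite !mxE.
    by rewrite big_split /= -!mulr_sumr !S; ring.
  by rewrite sum_mixed_plan.
move=> w; rewrite -(sum_mixed_plan theta a b (fun _ j => hinge w (z j))).
rewrite exchange_big; apply: eq_bigr => j _ /=.
by rewrite mxE mulr_sumr.
Qed.

Lemma strong_duality w : 0 <= eps -> exists (lambda : R) t (p : 'cV[R]_M),
  [/\ qp_feasible z (w, lambda, t), ambiguity_set z eps p &
      M%:R^-1 * (\sum_i t i 0) + lambda * eps = expected_hinge z w p].
Proof.
move=> eps0.
(* The identity map costs 0, so it is the point within budget that the envelope lemma asks for. *)
have cid : map_cost [ffun i => i] <= eps.
  by rewrite /map_cost big1 ?mulr0 // => i _; rewrite ffunE dist_pair_refl.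
have [lam [theta [a [b [lam0 th01 cost sup]]]]] :=
  concave_envelope_support (map_value w) cid.
have [p pA pE] := mixed_map_ambiguity th01 cost.
pose g i j := hinge w (z j) - lam * dist_pair (z i) (z j).
(* Rowwise maximizers of [g] form a single map, along which the least [t] feasible for [lam] is read
   off. *)
have [s smax] : exists s : {ffun 'I_M -> 'I_M}, forall i j, g i j <= g i (s i).
  exists [ffun i => [arg max_(j > i) g i j]%O] => i j; rewrite ffunE.
  by case: Order.TotalTheory.arg_maxP => // k _ /(_ j isT).
pose t : 'cV[R]_M := \col_i g i (s i).
have feas : qp_feasible z (w, lam, t).
  by apply/qp_feasibleE; split=> // i j; have := smax i j; rewrite mxE /g; lra.
exists lam, t, p; split=> //; apply/eqP; rewrite eq_le weak_duality // andbT.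
(* The dual value reduces to the value and cost of the one map [s], so the envelope bound at [s]
   closes the gap. *)
have -> : M%:R^-1 * (\sum_i t i 0) = map_value w s - lam * map_cost s.
  rewrite /map_value /map_cost mulrCA -mulrBr [lam * _]mulr_sumr -sumrB.
  by congr (_ * _); apply: eq_bigr => i _; rewrite mxE.
by rewrite pE; have := sup s; lra.
Qed.

Lemma worst_case_hinge_attained w lambda t p :
  qp_feasible z (w, lambda, t) -> ambiguity_set z eps p ->
  M%:R^-1 * (\sum_i t i 0) + lambda * eps = expected_hinge z w p ->
  worst_case_hinge z eps w = (expected_hinge z w p)%:E.
Proof.
move=> feas pA E; apply/eqP; rewrite eq_le; apply/andP; split.
  by apply: ge_ereal_sup => _ [q qA <-]; rewrite lee_fin -E weak_duality.
by apply: ereal_sup_ubound; exists p.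
Qed.

End InnerDuality.

(** * The second problem as a convex quadratic program in stacked variables *)

Lemma col_mx3_mul (R : realType) (d M : nat) (u : 'cV[R]_d) (l : R)
    (r : 'cV[R]_M) (x : 'cV[R]_(d + (1 + M))) :
  ((col_mx u (col_mx l%:M r))^T *m x) 0 0
  = (u^T *m (unstack x).1.1) 0 0 + l * (unstack x).1.2
    + (r^T *m (unstack x).2) 0 0.
Proof.
rewrite /unstack /= -{1}(vsubmxK x) -{1}(vsubmxK (dsubmx x)).
rewrite !tr_col_mx !mul_row_col tr_scalar_mx mul_scalar_mx !mxE addrA.
by [].
Qed.

Lemma l2norm_sqr (R : realType) (d : nat) (w : 'cV[R]_d) :
  l2norm w ^+ 2 = (w^T *m w) 0 0.
Proof.
rewrite sqr_sqrtr; last by apply: sumr_ge0 => i _; rewrite sqr_ge0.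
by rewrite mxE; apply: eq_bigr => i _; rewrite mxE expr2.
Qed.

Lemma qp_convex_quadratic (R : realType) (d M : nat)
    (z : 'I_M -> 'cV[R]_d * 'cV[R]_d) (C eps : R) :
  convex_quadratic_program [set x | qp_feasible z (unstack x)]
    (fun x : 'cV[R]_(d + (1 + M)) => qp_objective C eps (unstack x)).
Proof.
split.
  pose Q : 'M[R]_(d + (1 + M)) := block_mx 1%:M 0 0 0.
  have QE x : (x^T *m Q *m x) 0 0 = l2norm (unstack x).1.1 ^+ 2.
    rewrite l2norm_sqr /unstack /= -{1 2}(vsubmxK x) tr_col_mx mul_row_block.
    by rewrite !mulmx0 !addr0 mulmx1 mul_row_col mul0mx addr0.
  exists Q, (col_mx 0 (col_mx (C * eps)%:M (const_mx (C / M%:R)))); split.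
  - by rewrite tr_block_mx !trmx0 trmx1.
  - by move=> x; rewrite QE sqr_ge0.
  - move=> x; rewrite QE col_mx3_mul.
    case: (unstack x) => [[w l] t] /=; rewrite trmx0 mul0mx !mxE add0r.
    under [in RHS]eq_bigr do rewrite !mxE.
    by rewrite -mulr_sumr; ring.
pose D (q : 'I_M * 'I_M) := dist_pair (z q.1) (z q.2).
(* [None] indexes the sign constraint on lambda; the boolean separates the hinge constraint of a
   pair (true) from its nonnegativity constraint (false). *)
exists (option (bool * ('I_M * 'I_M))).
exists (fun k => if k is Some (h, q) then
   col_mx (if h then (z q.2).1 - (z q.2).2 else 0)
     (col_mx (D q)%:M (delta_mx q.1 0))
  else col_mx 0 (col_mx 1%:M 0)).
exists (fun k => if k is Some (true, _) then 1 else 0).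
have constraintE (u : 'cV[R]_d) i j x :
    ((col_mx u (col_mx (D (i, j))%:M (delta_mx i 0)))^T *m x) 0 0
    = ((unstack x).1.1^T *m u) 0 0
      + ((unstack x).2 i 0 + (unstack x).1.2 * D (i, j)).
  rewrite col_mx3_mul trmx_delta -rowE -[u^T *m _]trmxK trmx_mul trmxK.
  by rewrite ![_^T 0 0]mxE [row i _ 0 0]mxE; ring.
have row0 (x : 'cV[R]_(d + (1 + M))) :
    ((col_mx 0 (col_mx 1%:M 0))^T *m x) 0 0 = (unstack x).1.2.
  by rewrite col_mx3_mul !trmx0 !mul0mx !mxE add0r addr0 mul1r.
apply/seteqP; split => x.
  move=> [l0 h1 h0] [[[] [i j]]|] /=.
  - by rewrite constraintE -lerBlDl; exact: h1.
  - by rewrite constraintE mulmx0 mxE add0r; exact: h0.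
  - by rewrite row0.
move=> h; split=> [|i j|i j].
- by have := h None; rewrite /= row0.
- by have := h (Some (true, (i, j))); rewrite /= constraintE -lerBlDl.
- have := h (Some (false, (i, j))).
  by rewrite /= constraintE mulmx0 mxE add0r.
Qed.

Theorem lemma1 (R : realType) (d Np Nm : nat)
    (d_gt0 : (0 < d)%N) (Np_gt0 : (0 < Np)%N) (Nm_gt0 : (0 < Nm)%N)
    (xp : 'I_Np -> 'cV[R]_d) (xm : 'I_Nm -> 'cV[R]_d)
    (pairing : 'I_(Np * Nm)%N -> 'I_Np * 'I_Nm) (pairing_bij : bijective pairing)
    (z : 'I_(Np * Nm)%N -> 'cV[R]_d * 'cV[R]_d)
    (zE : forall i, z i = (xp (pairing i).1, xm (pairing i).2))
    (C eps : R) (C_gt0 : 0 < C) (eps_ge0 : 0 <= eps) :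
  [/\ (* the inner maximum is attained *)
      forall w : 'cV[R]_d, exists2 p : 'cV[R]_(Np * Nm),
        ambiguity_set z eps p & worst_case_hinge z eps w = (expected_hinge z w p)%:E,
      convex_quadratic_program
        [set x | qp_feasible z (unstack x)]
        (fun x : 'cV[R]_(d + (1 + Np * Nm)) => qp_objective C eps (unstack x)),
      optimal_value setT (drauc_objective z C eps)
        = optimal_value (qp_feasible z) (fun v => (qp_objective C eps v)%:E) &
      forall w : 'cV[R]_d,
        optimal setT (drauc_objective z C eps) w <->
        exists (lambda : R) (t : 'cV[R]_(Np * Nm)),
          optimal (qp_feasible z) (fun v => (qp_objective C eps v)%:E) (w, lambda, t)].

Proof.
(* The equivalence rests on two facts: each [w] lifts to a feasible triple of equal objective, and
   no feasible triple lies below the robust objective at its [w]. *)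
have dual w : exists (lambda : R) t,
    qp_feasible z (w, lambda, t) /\
    drauc_objective z C eps w = (qp_objective C eps (w, lambda, t))%:E.
  have [l [t [p [feas pA E]]]] := strong_duality z w eps_ge0.
  exists l, t; split=> //.
  rewrite /drauc_objective (worst_case_hinge_attained feas pA E).
  by rewrite /qp_objective E.
have weak v : qp_feasible z v ->
    (drauc_objective z C eps v.1.1 <= (qp_objective C eps v)%:E)%E.
  case: v => [[w l] t] feas /=.
  have [l' [t' [p [feas' pA E]]]] := strong_duality z w eps_ge0.
  rewrite /drauc_objective (worst_case_hinge_attained feas' pA E) lee_fin.
  by rewrite lerD2l ler_pM2l // weak_duality.
split.
- move=> w; have [l [t [p [feas pA E]]]] := strong_duality z w eps_ge0.
  by exists p => //; exact: worst_case_hinge_attained feas pA E.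
- exact: qp_convex_quadratic.
- apply/eqP; rewrite eq_le; apply/andP; split; apply: le_ereal_inf_tmp.
    move=> _ [v feas <-]; apply: le_trans (weak _ feas).
    by apply: ereal_inf_lbound; exists v.1.1.
  move=> _ [w _ <-]; have [l [t [feas ->]]] := dual w.
  by apply: ereal_inf_lbound; exists (w, l, t).
- move=> w; split.
    move=> [_ wopt]; have [l [t [feas E]]] := dual w.
    exists l, t; split=> // v feasv; rewrite -E.
    exact: le_trans (wopt _ I) (weak _ feasv).
  move=> [l [t [feas vopt]]]; split=> // w' _.
  have [l' [t' [feas' ->]]] := dual w'.
  exact: le_trans (weak _ feas) (vopt _ feas').
Qed.
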